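(* Let $n\geq 1$. For each $r$ with $1\leq r\leq n$, the $\mathbb C\mathfrak T_n$-module $\Lambda^r(\mathbb C^n)$ is a projective indecomposable module.
   Context: $\mathfrak T_n$ is the monoid of all self-maps of $[n]=\{1,\ldots,n\}$ under composition. All modules are left modules. $\mathbb C^n$ is the natural $\mathbb C\mathfrak T_n$-module: $fv_i=v_{f(i)}$ for $f\in\mathfrak T_n$, where $v_1,\ldots,v_n$ is the standard basis. Exterior powers are over $\mathbb C$, with $f(u_1\wedge\cdots\wedge u_r)=fu_1\wedge\cdots\wedge fu_r$ for $f\in\mathfrak T_n$. *)

(* Defs.v *)
From HB Require Import structures.
From mathcomp Require Import all_boot all_order all_algebra.
From mathcomp Require Import boolp reals.
From mathcomp Require Import complex.
From mathcomp Require Import finmap monalg.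

Set Implicit Arguments.
Unset Strict Implicit.
Unset Printing Implicit Defensive.

Import GRing.Theory.
Local Open Scope ring_scope.

#[short(type="finMonoidType")]
HB.structure Definition FinMonoid := {M of Finite M & Monoid M}.

(* The full transformation monoid: [fg = f \o g], so that it acts on the left.
   'I_n = {0, ..., n-1} stands for [n]. *)
Definition transf (n : nat) : predArgType := {ffun 'I_n -> 'I_n}.

Section Transf.
Variable n : nat.

HB.instance Definition _ := Finite.on (transf n).

Definition transf_mul (f g : transf n) : transf n := [ffun i => f (g i)].
Definition transf_one : transf n := [ffun i => i].

Lemma transf_mulA : associative transf_mul.
Proof. by move=> f g h; apply/ffunP=> i; rewrite !ffunE. Qed.
Lemma transf_mul1 : left_id transf_one transf_mul.
Proof. by move=> f; apply/ffunP=> i; rewrite !ffunE. Qed.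
Lemma transf_1mul : right_id transf_one transf_mul.
Proof. by move=> f; apply/ffunP=> i; rewrite !ffunE. Qed.

HB.instance Definition _ := isMonoid.Build (transf n)
  transf_mulA transf_mul1 transf_1mul.
End Transf.

(* The monoid algebra F[M]: functions M -> F under convolution. *)
Definition monoid_alg (F : nzRingType) (M : finMonoidType) : predArgType :=
  {ffun M -> F}.

Section MonoidAlg.
Variables (F : nzRingType) (M : finMonoidType).
Local Notation A := (monoid_alg F M).

HB.instance Definition _ := GRing.Zmodule.copy A {ffun M -> F}.

Definition monoid_alg_elt (f : M) : A := [ffun h => (h == f)%:R].

Definition monoid_alg_one : A := monoid_alg_elt 1%g.

Definition monoid_alg_mul (a b : A) : A :=
  [ffun h => \sum_(f : M) \sum_(g : M | (f * g)%g == h) a f * b g].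

Lemma monoid_alg_mulE (a b : A) (h : M) :
  monoid_alg_mul a b h = \sum_f \sum_g a f * b g * ((f * g)%g == h)%:R.
Proof.
rewrite ffunE; apply: eq_bigr => f _; rewrite big_mkcond; apply: eq_bigr => g _.
by case: eqP; rewrite ?mulr1 ?mulr0.
Qed.

Lemma sum_delta (T : finType) (h : T) (c : T -> F) :
  \sum_f c f * (f == h)%:R = c h.
Proof.
rewrite (bigD1 h) //= eqxx mulr1 big1 ?addr0 // => f /negPf ->.
by rewrite mulr0.
Qed.

Lemma monoid_alg_mulA : associative monoid_alg_mul.
Proof.
move=> a b c; apply/ffunP=> h; rewrite !monoid_alg_mulE.
transitivity (\sum_f \sum_g \sum_k
   a f * b g * c k * ((f * (g * k))%g == h)%:R).
  apply: eq_bigr => f _.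
  under eq_bigr => x _.
    rewrite monoid_alg_mulE mulr_sumr mulr_suml.
    under eq_bigr => g _ do rewrite mulr_sumr mulr_suml.
    over.
  rewrite exchange_big; apply: eq_bigr => g _.
  rewrite exchange_big; apply: eq_bigr => k _ /=.
  rewrite (bigD1 (g * k)%g) //= eqxx mulr1 !mulrA big1 ?addr0 //.
  by move=> x /negPf; rewrite eq_sym => ->; rewrite !mulr0 mul0r.
symmetry.
under eq_bigr => x _ do under eq_bigr => k _ do
  rewrite monoid_alg_mulE !mulr_suml.
under eq_bigr => x _ do under eq_bigr => k _ do
  under eq_bigr => f _ do rewrite !mulr_suml.
under eq_bigr => x _ do rewrite exchange_big.
rewrite exchange_big; apply: eq_bigr => f _ /=.
under eq_bigr => x _ do rewrite exchange_big.
rewrite exchange_big; apply: eq_bigr => g _ /=.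
rewrite exchange_big; apply: eq_bigr => k _ /=.
rewrite (bigD1 (f * g)%g) //= eqxx mulr1 mulgA big1 ?addr0 //.
by move=> x /negPf; rewrite eq_sym => ->; rewrite mulr0 !mul0r.
Qed.

Lemma monoid_alg_1mul : left_id monoid_alg_one monoid_alg_mul.
Proof.
move=> a; apply/ffunP=> h; rewrite monoid_alg_mulE (bigD1 1%g) //=.
rewrite [X in _ + X]big1 ?addr0; last first.
  by move=> f /negPf f1; rewrite big1 // => g _; rewrite ffunE f1 !mul0r.
under eq_bigr => g _ do rewrite ffunE eqxx mul1r mul1g.
exact: sum_delta.
Qed.

Lemma monoid_alg_mul1 : right_id monoid_alg_one monoid_alg_mul.
Proof.
move=> a; apply/ffunP=> h; rewrite monoid_alg_mulE exchange_big (bigD1 1%g) //=.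
rewrite [X in _ + X]big1 ?addr0; last first.
  by move=> g /negPf g1; rewrite big1 // => f _; rewrite ffunE g1 mulr0 mul0r.
under eq_bigr => g _ do rewrite ffunE eqxx mulr1 mulg1.
exact: sum_delta.
Qed.

Lemma monoid_alg_mulDl : left_distributive monoid_alg_mul +%R.
Proof.
move=> a b c; apply/ffunP=> h; rewrite !ffunE -big_split; apply: eq_bigr => f _.
by rewrite -big_split; apply: eq_bigr => g _ /=; rewrite ffunE mulrDl.
Qed.

Lemma monoid_alg_mulDr : right_distributive monoid_alg_mul +%R.
Proof.
move=> a b c; apply/ffunP=> h; rewrite !ffunE -big_split; apply: eq_bigr => f _.
by rewrite -big_split; apply: eq_bigr => g _ /=; rewrite ffunE mulrDr.
Qed.

Lemma monoid_alg_1neq0 : monoid_alg_one != 0.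
Proof.
by apply/eqP=> /ffunP/(_ 1%g)/eqP; rewrite !ffunE eqxx oner_eq0.
Qed.

HB.instance Definition _ := GRing.Zmodule_isNzRing.Build A
  monoid_alg_mulA monoid_alg_1mul monoid_alg_mul1
  monoid_alg_mulDl monoid_alg_mulDr monoid_alg_1neq0.
End MonoidAlg.

Record monoid_rep (F : nzRingType) (M : monoidType) (V : lmodType F) :=
  MonoidRep {
    rep_fun :> M -> {linear V -> V};
    rep_one : forall x, rep_fun 1%g x = x;
    rep_mul : forall f g x, rep_fun (f * g)%g x = rep_fun f (rep_fun g x)
  }.

(* V as a left F[M]-module. *)
Definition rep_module (F : comNzRingType) (M : finMonoidType) (V : lmodType F)
  (rho : monoid_rep M V) : Type := V.

Section RepModule.
Variables (F : comNzRingType) (M : finMonoidType) (V : lmodType F).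
Variable rho : monoid_rep M V.
Local Notation A := (monoid_alg F M).
Local Notation W := (rep_module rho).

HB.instance Definition _ := GRing.Zmodule.copy W V.

Definition rep_scale (a : A) (x : W) : W := \sum_(f : M) a f *: rho f (x : V).

Lemma rep_scaleA (a b : A) (x : W) :
  rep_scale a (rep_scale b x) = rep_scale (a * b) x.
Proof.
rewrite /rep_scale; under [RHS]eq_bigr => h _ do
  rewrite [(a * b) h]monoid_alg_mulE scaler_suml.
rewrite exchange_big; apply: eq_bigr => f _ /=.
under [RHS]eq_bigr => h _ do rewrite scaler_suml.
rewrite exchange_big linear_sum scaler_sumr; apply: eq_bigr => g _ /=.
rewrite (bigD1 (f * g)%g) //= eqxx mulr1 big1 ?addr0; last first.
  by move=> h /negPf; rewrite eq_sym => ->; rewrite mulr0 scale0r.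
by rewrite linearZ /= rep_mul scalerA.
Qed.

Lemma rep_scale1 : left_id 1 rep_scale.
Proof.
move=> x; rewrite /rep_scale (bigD1 1%g) //= ffunE eqxx scale1r rep_one.
rewrite big1 ?addr0 // => f /negPf f1.
by rewrite ffunE f1 scale0r.
Qed.

Lemma rep_scaleDr : right_distributive rep_scale +%R.
Proof.
move=> a x y; rewrite /rep_scale -big_split; apply: eq_bigr => f _ /=.
by rewrite linearD scalerDr.
Qed.

Lemma rep_scaleDl (x : W) : {morph rep_scale^~ x : a b / a + b}.
Proof.
move=> a b; rewrite /rep_scale -big_split; apply: eq_bigr => f _ /=.
by rewrite ffunE scalerDl.
Qed.

HB.instance Definition _ := GRing.Zmodule_isLmodule.Build A W
  rep_scaleA rep_scale1 rep_scaleDr rep_scaleDl.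

Lemma rep_module_eltE (f : M) (x : W) :
  monoid_alg_elt F f *: x = rho f (x : V) :> V.
Proof.
rewrite [LHS]/(rep_scale _ _) /rep_scale (bigD1 f) //= ffunE eqxx scale1r.
rewrite big1 ?addr0 // => g /negPf gf.
by rewrite ffunE gf scale0r.
Qed.
End RepModule.

Section LmodQuotient.
Variables (F : nzRingType) (L : lmodType F) (S : {pred L}).
Hypothesis S_submod : submod_closed S.
Local Open Scope quotient_scope.

Definition submod_pred of submod_closed S : L -> bool := S.
HB.instance Definition _ := GRing.isZmodClosed.Build L (submod_pred S_submod)
  (GRing.submod_closedB S_submod).
Definition submod_zmodClosed : zmodClosed L :=
  GRing.ZmodClosed.clone L (submod_pred S_submod) _.

Definition lmod_quot : Type := Quotient.quot submod_zmodClosed.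
HB.instance Definition _ := GRing.Zmodule.on lmod_quot.

Definition lmod_pi (x : L) : lmod_quot := \pi_(Quotient.quot submod_zmodClosed) x.
Definition lmod_repr (x : lmod_quot) : L :=
  repr (x : Quotient.quot submod_zmodClosed).

Lemma lmod_reprK : cancel lmod_repr lmod_pi.
Proof. by move=> x; exact: reprK. Qed.

Lemma lmod_piP x y : lmod_pi x = lmod_pi y <-> x - y \in S.
Proof.
rewrite -[_ \in S]/(x - y \in (submod_zmodClosed : {pred L})).
by rewrite Quotient.idealrBE; split=> /eqP.
Qed.

Lemma lmod_repr_pi x : lmod_repr (lmod_pi x) - x \in S.
Proof. by apply/lmod_piP; rewrite lmod_reprK. Qed.

Lemma lmod_piD x y : lmod_pi (x + y) = lmod_pi x + lmod_pi y.
Proof. by rewrite /lmod_pi raddfD. Qed.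

Definition lmod_quot_scale (a : F) (x : lmod_quot) : lmod_quot :=
  lmod_pi (a *: lmod_repr x).

Lemma lmod_piZ a x : lmod_pi (a *: x) = lmod_quot_scale a (lmod_pi x).
Proof.
apply/esym/lmod_piP; rewrite -scalerBr -[a *: _]addr0.
exact: S_submod.2 (lmod_repr_pi x) S_submod.1.
Qed.

Lemma lmod_quot_scaleA a b x :
  lmod_quot_scale a (lmod_quot_scale b x) = lmod_quot_scale (a * b) x.
Proof. by rewrite -[x]lmod_reprK -!lmod_piZ scalerA. Qed.

Lemma lmod_quot_scale1 : left_id 1 lmod_quot_scale.
Proof. by move=> x; rewrite -[x]lmod_reprK -lmod_piZ scale1r. Qed.

Lemma lmod_quot_scaleDr : right_distributive lmod_quot_scale +%R.
Proof.
move=> a x y; rewrite -[x]lmod_reprK -[y]lmod_reprK -lmod_piD -!lmod_piZ.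
by rewrite scalerDr lmod_piD.
Qed.

Lemma lmod_quot_scaleDl x : {morph lmod_quot_scale^~ x : a b / a + b}.
Proof.
by move=> a b; rewrite -[x]lmod_reprK -!lmod_piZ -lmod_piD scalerDl.
Qed.

HB.instance Definition _ := GRing.Zmodule_isLmodule.Build F lmod_quot
  lmod_quot_scaleA lmod_quot_scale1 lmod_quot_scaleDr lmod_quot_scaleDl.

Lemma lmod_pi_linear : linear lmod_pi.
Proof. by move=> a x y; rewrite lmod_piD lmod_piZ. Qed.
HB.instance Definition _ := GRing.isLinear.Build F L lmod_quot *:%R lmod_pi
  lmod_pi_linear.
End LmodQuotient.

Section FreeLift.
Variables (F : nzRingType) (K : choiceType) (W : lmodType F) (h : K -> W).

(* The linear extension of h to the free module on K. *)
Definition free_lift (g : {malg F[K]}) : W := \sum_(k <- msupp g) g@_k *: h k.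

Lemma free_lift_wider (g : {malg F[K]}) (d : {fset K}) :
  (msupp g `<=` d)%fset -> free_lift g = \sum_(k <- d) g@_k *: h k.
Proof.
move=> gd; rewrite /free_lift; apply: big_fset_incl => // k _ kg.
by rewrite mcoeff_outdom ?scale0r.
Qed.

Lemma free_lift_linear : linear free_lift.
Proof.
move=> a x y.
have sx : (msupp x `<=` msupp x `|` msupp y)%fset by exact: fsubsetUl.
have sy : (msupp y `<=` msupp x `|` msupp y)%fset by exact: fsubsetUr.
have sxy : (msupp (a *: x + y) `<=` msupp x `|` msupp y)%fset.
  apply: fsubset_trans (msuppD_le _ _) _; apply: fsetSU; exact: msuppZ_le.
rewrite (free_lift_wider sx) (free_lift_wider sy) (free_lift_wider sxy).
rewrite scaler_sumr -big_split; apply: eq_bigr => k _ /=.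
by rewrite mcoeffD mcoeffZ scalerDl scalerA.
Qed.
HB.instance Definition _ := GRing.isLinear.Build F {malg F[K]} W *:%R free_lift
  free_lift_linear.

Lemma free_liftU k : free_lift << k >> = h k.
Proof.
rewrite (free_lift_wider msuppU_le) big_seq_fset1.
by rewrite mcoeffUU scale1r.
Qed.
End FreeLift.

(* The exterior power of a module V: the free module on V^r modulo the
   submodule generated by the relations of multilinearity and alternation. *)
Section ExteriorPower.
Variables (F : comNzRingType) (r : nat).

Definition upd (V : Type) (t : {ffun 'I_r -> V}) (i : 'I_r) (x : V) :
  {ffun 'I_r -> V} := [ffun j => if j == i then x else t j].

Definition alternating (V W : lmodType F) (h : {ffun 'I_r -> V} -> W) : Prop :=
  (forall t i (a : F) (x y : V),
     h (upd t i (a *: x + y)) = a *: h (upd t i x) + h (upd t i y)) /\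
  (forall (t : {ffun 'I_r -> V}) (i j : 'I_r), i != j -> t i = t j -> h t = 0).

Variable V : lmodType F.
Local Notation free := {malg F[{ffun 'I_r -> V}]}.

Inductive ext_relation : free -> Prop :=
| ExtRel_zero : ext_relation 0
| ExtRel_comb (a : F) (p q : free) :
    ext_relation p -> ext_relation q -> ext_relation (a *: p + q)
| ExtRel_linear (t : {ffun 'I_r -> V}) (i : 'I_r) (a : F) (x y : V) :
    ext_relation (<< upd t i (a *: x + y) >>
                  - (a *: << upd t i x >> + << upd t i y >>))
| ExtRel_alt (t : {ffun 'I_r -> V}) (i j : 'I_r) :
    i != j -> t i = t j -> ext_relation << t >>.

Definition ext_sub : pred free := fun p => `[< ext_relation p >].

Lemma ext_sub_submod : submod_closed ext_sub.
Proof.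
split=> [|a p q /asboolP pI /asboolP qI]; apply/asboolP.
  exact: ExtRel_zero.
exact: ExtRel_comb.
Qed.

Definition ext_power : lmodType F := lmod_quot ext_sub_submod.

Definition wedge (t : {ffun 'I_r -> V}) : ext_power := lmod_pi ext_sub_submod << t >>.

Lemma wedge_alternating : alternating wedge.
Proof.
split=> [t i a x y|t i j ij tij].
  rewrite /wedge -linearP; apply/lmod_piP/asboolP; exact: ExtRel_linear.
rewrite /wedge -[RHS](linear0 (lmod_pi ext_sub_submod)).
by apply/lmod_piP; rewrite subr0; apply/asboolP; apply: ExtRel_alt ij tij.
Qed.

Lemma ext_power_ext (W : lmodType F) (g1 g2 : {linear ext_power -> W}) :
  (forall t, g1 (wedge t) = g2 (wedge t)) -> g1 =1 g2.
Proof.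
move=> eq12 x; rewrite -[x]lmod_reprK; set p := lmod_repr x.
rewrite [p]monalgE !raddf_sum; apply: eq_bigr => k _ /=.
have -> : << p@_k *g k >> = p@_k *: << k >> :> free.
  by apply/malgP=> k'; rewrite mcoeffZ !mcoeffU mulr_natr.
by rewrite !linearZ /=; congr (_ *: _); exact: eq12.
Qed.

Section Lift.
Variables (W : lmodType F) (h : {ffun 'I_r -> V} -> W).

(* The linear map induced by an alternating map h. *)
Definition ext_lift (x : ext_power) : W := free_lift h (lmod_repr x).

Hypothesis hP : alternating h.

Lemma free_lift_relation p : ext_relation p -> free_lift h p = 0.
Proof.
elim=> [|a p1 p2 _ IH1 _ IH2|t i a x y|t i j ij tij].
- exact: linear0.
- by rewrite linearP /= IH1 IH2 scaler0 addr0.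
- by rewrite linearB linearP /= !free_liftU hP.1 subrr.
- by rewrite free_liftU (hP.2 _ _ _ ij tij).
Qed.

Lemma ext_lift_pi p : ext_lift (lmod_pi ext_sub_submod p) = free_lift h p.
Proof.
apply/eqP; rewrite -subr_eq0 -linearB; apply/eqP/free_lift_relation.
exact/asboolP/(lmod_repr_pi ext_sub_submod).
Qed.

Lemma ext_lift_wedge t : ext_lift (wedge t) = h t.
Proof. by rewrite ext_lift_pi free_liftU. Qed.

Lemma ext_lift_linear : linear ext_lift.
Proof.
move=> a x y; rewrite -[x]lmod_reprK -[y]lmod_reprK -linearP !ext_lift_pi.
exact: linearP.
Qed.
End Lift.
End ExteriorPower.

Section ExteriorMap.
Variables (F : comNzRingType) (r : nat) (V W : lmodType F).
Variable g : {linear V -> W}.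

(* u_1 /\ ... /\ u_r |-> g u_1 /\ ... /\ g u_r; see [ext_map_wedge]. *)
Definition ext_map : ext_power r V -> ext_power r W :=
  ext_lift (fun t : {ffun 'I_r -> V} => wedge [ffun i => g (t i)]).

Lemma ext_map_alternating :
  alternating (fun t : {ffun 'I_r -> V} => wedge [ffun i => g (t i)]).
Proof.
have updE (t : {ffun 'I_r -> V}) i x :
    [ffun j => g (upd t i x j)] = upd [ffun j => g (t j)] i (g x).
  by apply/ffunP=> j; rewrite !ffunE; case: eqP.
split=> [t i a x y|t i j ij tij].
  by rewrite !updE linearP (wedge_alternating r W).1.
by apply: (wedge_alternating r W).2 ij _; rewrite !ffunE tij.
Qed.

HB.instance Definition _ :=
  GRing.isLinear.Build F (ext_power r V) (ext_power r W) *:%R ext_map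
    (ext_lift_linear ext_map_alternating).

Lemma ext_map_wedge t : ext_map (wedge t) = wedge [ffun i => g (t i)].
Proof. exact: (ext_lift_wedge ext_map_alternating). Qed.
End ExteriorMap.

Section ExteriorRep.
Variables (F : comNzRingType) (M : monoidType) (V : lmodType F).
Variables (rho : monoid_rep M V) (r : nat).

Definition ext_rep_fun (f : M) : {linear ext_power r V -> ext_power r V} :=
  ext_map (rho f).

Lemma ext_rep_one x : ext_rep_fun 1%g x = x.
Proof.
apply: (ext_power_ext (g1 := ext_rep_fun 1%g) (g2 := idfun)) => t /=.
rewrite ext_map_wedge; congr wedge.
by apply/ffunP=> i; rewrite ffunE rep_one.
Qed.

Lemma ext_rep_mul f g x :
  ext_rep_fun (f * g)%g x = ext_rep_fun f (ext_rep_fun g x).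
Proof.
apply: (ext_power_ext (g1 := ext_rep_fun (f * g)%g)
                      (g2 := ext_rep_fun f \o ext_rep_fun g)) => t /=.
rewrite !ext_map_wedge; congr wedge.
by apply/ffunP=> i; rewrite !ffunE rep_mul.
Qed.

Definition ext_rep : monoid_rep M (ext_power r V) :=
  MonoidRep ext_rep_one ext_rep_mul.
End ExteriorRep.

(* F^n, with the action determined by f v_i = v_(f i). *)
Section NaturalRep.
Variables (F : comNzRingType) (n : nat).

Definition nat_act (f : transf n) (v : 'cV[F]_n) : 'cV[F]_n :=
  \sum_i v i 0 *: delta_mx (f i) 0.

Lemma nat_act_linear f : linear (nat_act f).
Proof.
move=> a u v; rewrite /nat_act scaler_sumr -big_split; apply: eq_bigr => i _ /=.
by rewrite !mxE scalerDl scalerA.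
Qed.
HB.instance Definition _ f :=
  GRing.isLinear.Build F 'cV[F]_n 'cV[F]_n *:%R (nat_act f) (nat_act_linear f).

Lemma nat_act_delta f i : nat_act f (delta_mx i 0) = delta_mx (f i) 0.
Proof.
rewrite /nat_act (bigD1 i) //= mxE !eqxx scale1r big1 ?addr0 // => j /negPf ji.
by rewrite mxE ji scale0r.
Qed.

Lemma nat_act_one v : nat_act 1%g v = v.
Proof.
rewrite [RHS]matrix_sum_delta; apply: eq_bigr => i _.
by rewrite big_ord1 ffunE.
Qed.

Lemma nat_act_mul f g v : nat_act (f * g)%g v = nat_act f (nat_act g v).
Proof.
rewrite [nat_act g v]/nat_act linear_sum; apply: eq_bigr => i _ /=.
by rewrite linearZ /= nat_act_delta ffunE.
Qed.

Definition nat_rep : monoid_rep (transf n) 'cV[F]_n :=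
  MonoidRep nat_act_one nat_act_mul.
End NaturalRep.

Definition ext_natural (F : comNzRingType) (n r : nat) :
  lmodType (monoid_alg F (transf n)) := rep_module (ext_rep (nat_rep F n) r).

Definition projective (A : nzRingType) (P : lmodType A) : Prop :=
  forall (X Y : lmodType A) (g : {linear X -> Y}) (f : {linear P -> Y}),
    (forall y, exists x, g x = y) ->
    exists h : {linear P -> X}, forall p, g (h p) = f p.

Definition indecomposable (A : nzRingType) (P : lmodType A) : Prop :=
  (exists x : P, x != 0) /\
  forall U W : {pred P}, submod_closed U -> submod_closed W ->
    (forall x, exists u w, [/\ u \in U, w \in W & x = u + w]) ->
    (forall x, x \in U -> x \in W -> x = 0) ->
    (forall x, x \in U -> x = 0) \/ (forall x, x \in W -> x = 0).

(* Main.v *)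
(** Let w0 = v_1 /\ ... /\ v_r.  The map a |-> a w0 from the regular module to
    Lambda^r splits: sending u_1 /\ ... /\ u_r to the sum over all
    phi : [r] -> [n] of det (phi(j)-th coordinate of u_i) times [phi o e], with
    e the retraction of [n] onto [r], is a module map, and composing it with
    a |-> a w0 gives multiplication by r!.  Hence Lambda^r is a retract of the
    regular module, so it is projective.  Moreover e maps Lambda^r onto the line
    spanned by the generator w0; in a decomposition w0 = u + w, one of e u, e w
    is a nonzero multiple of w0, so one of the two summands is everything. *)

Require Import Defs.
From HB Require Import structures.
From mathcomp Require Import all_boot all_order all_algebra.
From mathcomp Require Import reals complex.
From mathcomp Require Import fingroup perm.
Local Open Scope ring_scope.
Import GRing.Theory Num.Theory.

(** * Alternating multilinear maps *)

Lemma upd_id {r} {V : Type} (t : {ffun 'I_r -> V}) (i : 'I_r) : upd t i (t i) = t.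
Proof. by apply/ffunP=> j; rewrite ffunE; case: eqP => [->|]. Qed.

Section Alternating.
Context {F : comNzRingType} {r : nat} {V W : lmodType F}.
Variable h : {ffun 'I_r -> V} -> W.
Hypothesis hP : alternating h.

Lemma alternating_updD t i x y :
  h (upd t i (x + y)) = h (upd t i x) + h (upd t i y).
Proof. by have := hP.1 t i 1 x y; rewrite !scale1r. Qed.

Lemma alternating_upd0 t i : h (upd t i 0) = 0.
Proof.
have := alternating_updD t i 0 0; rewrite addr0 => /eqP.
by rewrite -subr_eq subrr eq_sym => /eqP.
Qed.

Lemma alternating_updZ t i a x : h (upd t i (a *: x)) = a *: h (upd t i x).
Proof. by have := hP.1 t i a x 0; rewrite addr0 alternating_upd0 addr0. Qed.

Lemma alternating_upd_sum t i (I : finType) (G : I -> V) :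
  h (upd t i (\sum_k G k)) = \sum_k h (upd t i (G k)).
Proof.
exact: (big_morph (fun x => h (upd t i x)) (alternating_updD t i)
  (alternating_upd0 t i)).
Qed.

(** Put [t a + t b] in both slots [a] and [b]: the value is 0, and expanding it leaves only the two
    cross terms, which therefore cancel. *)
Lemma alternating_tperm (t : {ffun 'I_r -> V}) a b : a != b ->
  h [ffun i => t (tperm a b i)] = - h t.
Proof.
move=> ab; have ba : b == a = false by rewrite eq_sym (negPf ab).
pose u x y := upd (upd t a x) b y.
have u0 x : h (u x x) = 0.
  by apply: (hP.2 _ a b ab); rewrite !ffunE eqxx (negPf ab) eqxx.
have uC x y : u x y = upd (upd t b y) a x.
  apply/ffunP=> i; rewrite !ffunE; have [->|//] := eqVneq i b.
  by rewrite ba.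
have uD x1 x2 y : h (u (x1 + x2) y) = h (u x1 y) + h (u x2 y).
  by rewrite !uC alternating_updD.
have ut : u (t a) (t b) = t.
  by apply/ffunP=> i; rewrite !ffunE; do 2?case: eqP => [->|].
have ut' : u (t b) (t a) = [ffun i => t (tperm a b i)].
  apply/ffunP=> i; rewrite !ffunE; case: tpermP => [->|->|/eqP ia /eqP ib].
  - by rewrite eqxx (negPf ab).
  - by rewrite eqxx.
  - by rewrite (negPf ia) (negPf ib).
have := u0 (t a + t b); rewrite uD /u !alternating_updD -!/(u _ _) !u0.
by rewrite add0r addr0 ut ut' addrC => /eqP; rewrite addr_eq0 => /eqP.
Qed.

(** Induction on a factorization of [s] into transpositions, each contributing one sign. *)
Lemma alternating_perm (t : {ffun 'I_r -> V}) (s : 'S_r) :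
  h [ffun i => t (s i)] = (-1) ^+ s *: h t.
Proof.
have [ts -> dts] := prod_tpermP s.
elim: ts dts t => [_|[a b] ts IH /= /andP[ab dts]] t.
  rewrite big_nil odd_perm1 scale1r; congr h.
  by apply/ffunP=> i; rewrite ffunE perm1.
rewrite big_cons /= odd_mul_tperm ab signr_addb expr1 mulN1r scaleNr.
set p := (\prod_(_ <- _) _)%g in IH *.
have -> : [ffun i => t ((tperm a b * p)%g i)]
    = [ffun i => [ffun j => t (p j)] (tperm a b i)].
  by apply/ffunP=> i; rewrite !ffunE permM.
by rewrite alternating_tperm // IH.
Qed.

End Alternating.

(** * Wedges of standard basis vectors, and minors *)

Section BasisWedge.
Context {F : comNzRingType} {n r : nat}.

Definition basis_wedge (phi : {ffun 'I_r -> 'I_n}) : ext_power r 'cV[F]_n :=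
  wedge [ffun i => delta_mx (phi i) 0].

(** Multilinearity allows the slots of a wedge to be expanded in the standard basis one after the
    other. *)
Lemma ext_power_basis_ext (W : lmodType F)
    (g1 g2 : {linear ext_power r 'cV[F]_n -> W}) :
  (forall phi, g1 (basis_wedge phi) = g2 (basis_wedge phi)) -> g1 =1 g2.
Proof.
move=> eq12; apply: ext_power_ext => t.
have wP := wedge_alternating r 'cV[F]_n.
(* Slots from [k] on already hold basis vectors: [k = r] is no condition at all, and [k = 0] is the
   case of basis wedges. *)
suff basis_from (k : nat) (u : {ffun 'I_r -> 'cV[F]_n}) :
    (forall i : 'I_r, (k <= i)%N -> exists m, u i = delta_mx m 0) ->
    g1 (wedge u) = g2 (wedge u).
  by apply: (basis_from r) => i; rewrite leqNgt ltn_ord.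
elim: k u => [|k IH] u uP.
  have [phi phiE] := fin_all_exists (fun i => uP i isT).
  suff -> : wedge u = basis_wedge (finfun phi) by [].
  by congr wedge; apply/ffunP=> i; rewrite !ffunE phiE.
have [rk|kr] := leqP r k.
  apply: IH => i ki; have := leq_trans rk ki.
  by rewrite leqNgt ltn_ord.
pose i0 := Ordinal kr.
have -> : u = upd u i0 (\sum_m u i0 m 0 *: delta_mx m 0).
  rewrite -[LHS](upd_id u i0); congr upd; rewrite [LHS]matrix_sum_delta.
  by apply: eq_bigr => m _; rewrite big_ord1.
rewrite (alternating_upd_sum _ wP) !linear_sum; apply: eq_bigr => m _ /=.
rewrite (alternating_updZ _ wP) !linearZ /=; congr (_ *: _).
apply: IH => i ki; rewrite ffunE; case: eqP => [_|/eqP ii0]; first by exists m.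
by apply: uP; rewrite ltn_neqAle ki andbT eq_sym.
Qed.

Lemma basis_wedge_perm (phi : {ffun 'I_r -> 'I_n}) (s : 'S_r) :
  basis_wedge [ffun i => phi (s i)] = (-1) ^+ s *: basis_wedge phi.
Proof.
rewrite -(alternating_perm _ (wedge_alternating r 'cV[F]_n)); congr wedge.
by apply/ffunP=> i; rewrite !ffunE.
Qed.

Lemma ext_rep_basis_wedge (f : transf n) (phi : {ffun 'I_r -> 'I_n}) :
  ext_rep (nat_rep F n) r f (basis_wedge phi)
    = basis_wedge [ffun i => f (phi i)].
Proof.
rewrite [LHS]ext_map_wedge; congr wedge.
by apply/ffunP=> i; rewrite !ffunE [LHS]nat_act_delta.
Qed.

Definition minor_mx (phi : {ffun 'I_r -> 'I_n}) (t : {ffun 'I_r -> 'cV[F]_n}) :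
  'M[F]_r := \matrix_(i, j) t i (phi j) 0.

(** The vectors of [t] supply the rows of the minor, so this is the behaviour of the determinant in
    its rows. *)
Lemma det_minor_alternating (phi : {ffun 'I_r -> 'I_n}) :
  alternating (fun t => \det (minor_mx phi t) : F^o).
Proof.
split=> [t i a x y|t i j ij tij]; last first.
  by apply: (determinant_alternate ij) => k; rewrite !mxE tij.
rewrite -[in RHS](mul1r (\det (minor_mx phi (upd t i y)))).
apply: (@determinant_multilinear _ _ _ _ _ i a 1).
- by apply/rowP=> j; rewrite !mxE !ffunE eqxx !mxE mul1r.
- by apply/matrixP=> k j; rewrite !mxE !ffunE eq_sym (negPf (neq_lift _ _)).
- by apply/matrixP=> k j; rewrite !mxE !ffunE eq_sym (negPf (neq_lift _ _)).
Qed.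

(** The functional induced by the minor at [phi] itself takes the value 1 here, the minor being the
    identity matrix. *)
Lemma basis_wedge_neq0 (phi : {ffun 'I_r -> 'I_n}) :
  injective phi -> basis_wedge phi != 0.
Proof.
move=> phi_inj; apply/eqP=> phi0.
have := ext_lift_wedge (det_minor_alternating phi) [ffun i => delta_mx (phi i) 0].
have -> : minor_mx phi [ffun i => delta_mx (phi i) 0] = 1%:M.
  by apply/matrixP=> i j; rewrite !mxE !ffunE mxE andbT (inj_eq phi_inj) eq_sym.
rewrite -/(basis_wedge phi) phi0 det1.
rewrite -[0](linear0 (lmod_pi (ext_sub_submod r 'cV[F]_n))).
rewrite (ext_lift_pi (det_minor_alternating phi)) linear0.
by move/eqP; rewrite eq_sym oner_eq0.
Qed.

End BasisWedge.

(** * Products in the monoid algebra *)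

Section MonoidAlgebra.
Context {F : comNzRingType} {M : finMonoidType}.

Lemma monoid_alg_eltM (f g : M) :
  monoid_alg_elt F f * monoid_alg_elt F g = monoid_alg_elt F (f * g)%g.
Proof.
apply/ffunP=> h; rewrite [LHS]monoid_alg_mulE ffunE (bigD1 f) //= (bigD1 g) //=.
rewrite big1 => [|k /negPf kg]; last by rewrite !ffunE kg mulr0 mul0r.
rewrite big1 => [|k /negPf kf]; last first.
  by rewrite big1 // => l _; rewrite !ffunE kf !mul0r.
by rewrite !ffunE !eqxx !mul1r !addr0 eq_sym.
Qed.

(* [F^o] endows the functions underlying the monoid algebra with their F-module
   structure. *)
Lemma monoid_alg_mul_linear (a : monoid_alg F M) :
  linear (fun b : {ffun M -> F^o} => (a * (b : monoid_alg F M)) : {ffun M -> F^o}).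
Proof.
move=> k x y; rewrite mulrDr; congr (_ + _); apply/ffunP=> h.
rewrite [LHS]monoid_alg_mulE ffunE [X in _ = _ *: X]monoid_alg_mulE scaler_sumr.
apply: eq_bigr => f _; rewrite scaler_sumr; apply: eq_bigr => g _.
by rewrite ffunE /GRing.scale /= mulrCA !mulrA.
Qed.

(** Reduces linearity over the algebra to linearity over [F] together with compatibility with the
    monoid elements. *)
Lemma monoid_alg_elt_sum (a b : monoid_alg F M) :
  a * b = \sum_f a f *: (monoid_alg_elt F f * b : {ffun M -> F^o}).
Proof.
apply/ffunP=> h; rewrite [LHS]monoid_alg_mulE sum_ffunE; apply: eq_bigr => f _.
rewrite ffunE [X in _ *: X]monoid_alg_mulE [X in _ *: X](bigD1 f) //= ffunE eqxx.
rewrite [X in _ + X]big1 => [|k /negPf kf]; last first.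
  by rewrite big1 // => g _; rewrite ffunE kf !mul0r.
rewrite addr0 scaler_sumr; apply: eq_bigr => g _.
by rewrite mul1r /GRing.scale /= mulrA.
Qed.

End MonoidAlgebra.

(** * The exterior power as a retract of the regular module, up to the factor r! *)

Section Retract.
Context {F : comNzRingType} {n r' : nat}.
Local Notation r := r'.+1.
Local Notation P := (ext_natural F n r).
Local Notation A := (monoid_alg F (transf n)).
Local Notation AF := {ffun transf n -> F^o}.
Hypothesis r_le_n : (r <= n)%N.

(* [inord i] is [0] for [i >= r], so this is phi composed with the retraction e. *)
Definition extend_transf (phi : {ffun 'I_r -> 'I_n}) : transf n :=
  [ffun i : 'I_n => phi (inord i)].

Definition initial_emb : {ffun 'I_r -> 'I_n} := [ffun i => widen_ord r_le_n i].

Definition initial_wedge : P := basis_wedge initial_emb.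

Lemma initial_emb_inj : injective initial_emb.
Proof. by move=> i j; rewrite !ffunE => /(congr1 val) /= /val_inj. Qed.

Lemma extend_transf_emb phi i : extend_transf phi (initial_emb i) = phi i.
Proof. by rewrite !ffunE inord_val. Qed.

Lemma mul_extend_transf (f : transf n) phi :
  (f * extend_transf phi)%g = extend_transf [ffun i => f (phi i)].
Proof. by apply/ffunP=> i; rewrite !ffunE. Qed.

(** Coefficients that are minors make this alternating in [t], so that it descends to the exterior
    power. *)
Definition antisym (t : {ffun 'I_r -> 'cV[F]_n}) : AF :=
  \sum_phi \det (minor_mx phi t)
    *: (monoid_alg_elt F (extend_transf phi) : AF).

Lemma antisym_alternating : alternating antisym.
Proof.
split=> [t i a x y|t i j ij tij].
  rewrite scaler_sumr -big_split; apply: eq_bigr => phi _ /=.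
  by rewrite (det_minor_alternating phi).1 scalerDl scalerA.
apply: big1 => phi _.
by rewrite ((det_minor_alternating phi).2 _ _ _ ij tij) scale0r.
Qed.

Definition section_map : ext_power r 'cV[F]_n -> AF := ext_lift antisym.

HB.instance Definition _ :=
  GRing.isLinear.Build F (ext_power r 'cV[F]_n) AF *:%R section_map
    (ext_lift_linear antisym_alternating).

(** In the Leibniz expansion of the minors, the term of a permutation [s] survives only for [phi]
    equal to [chi] composed with [s]. *)
Lemma section_map_basis chi :
  section_map (basis_wedge chi) =
    \sum_(s : 'S_r) (-1) ^+ s
      *: (monoid_alg_elt F (extend_transf [ffun i => chi (s i)]) : AF).
Proof.
rewrite [LHS](ext_lift_wedge antisym_alternating).
(* Transposing makes the surviving [phi] involve [s] rather than its inverse. *)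
rewrite /antisym; under eq_bigr => phi _ do rewrite -det_tr /determinant scaler_suml.
rewrite exchange_big; apply: eq_bigr => s _ /=.
rewrite (bigD1 [ffun i => chi (s i)]) //= [X in _ + X]big1 ?addr0.
  congr (_ *: _); rewrite big1 ?mulr1 // => i _.
  by rewrite !mxE !ffunE mxE !eqxx.
move=> phi phi_s; have [i phi_i] : exists i : 'I_r, phi i != chi (s i).
  apply/existsP; rewrite -negb_forall; apply: contra phi_s => /forallP phi_s.
  by apply/eqP/ffunP=> i; rewrite ffunE; apply/eqP.
by rewrite (bigD1 i) //= !mxE !ffunE mxE (negPf phi_i) mul0r mulr0 scale0r.
Qed.

(** On basis wedges both sides are signed sums over permutations, and composing with [f] on the left
    commutes with permuting the slots on the right. *)
Lemma section_map_elt (f : transf n) x :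
  section_map (ext_rep (nat_rep F n) r f x)
    = monoid_alg_elt F f * (section_map x : A).
Proof.
pose mulf : AF -> AF := fun b => monoid_alg_elt F f * (b : A).
have [mulfM mulfE] : exists m : {linear AF -> AF}, m =1 mulf.
  pose mulfL := GRing.isLinear.Build F AF AF *:%R mulf
    (monoid_alg_mul_linear (monoid_alg_elt F f)).
  by pose m : {linear AF -> AF} := HB.pack mulf mulfL; exists m.
pose g1 : {linear _ -> AF} := section_map \o ext_rep (nat_rep F n) r f.
pose g2 : {linear _ -> AF} := mulfM \o section_map.
suff g12 : g1 =1 g2 by rewrite -[RHS]mulfE; exact: g12 x.
apply: ext_power_basis_ext => phi.
rewrite /= ext_rep_basis_wedge !section_map_basis linear_sum.
apply: eq_bigr => s _; rewrite linearZ /=; congr (_ *: _).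
rewrite mulfE /mulf monoid_alg_eltM mul_extend_transf.
by congr (monoid_alg_elt F (extend_transf _)); apply/ffunP=> i; rewrite !ffunE.
Qed.

Lemma section_map_scale (a : A) (x : P) :
  section_map (a *: x) = a * (section_map x : A).
Proof.
rewrite monoid_alg_elt_sum [section_map _](linear_sum section_map).
by apply: eq_bigr => f _; rewrite linearZ /= section_map_elt.
Qed.

Lemma extend_transf_wedge phi :
  monoid_alg_elt F (extend_transf phi) *: initial_wedge = basis_wedge phi :> P.
Proof.
rewrite rep_module_eltE [LHS]ext_rep_basis_wedge; congr basis_wedge.
by apply/ffunP=> i; rewrite ffunE extend_transf_emb.
Qed.

Definition eval_wedge (a : AF) : ext_power r 'cV[F]_n :=
  (a : A) *: initial_wedge.

Lemma eval_wedge_linear : linear eval_wedge.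
Proof.
move=> k a b; rewrite /eval_wedge scalerDl; congr (_ + _).
rewrite [LHS]/(rep_scale _ _) [X in _ = _ *: X]/(rep_scale _ _) /rep_scale.
rewrite scaler_sumr; apply: eq_bigr => f _.
by rewrite ffunE scalerA.
Qed.

HB.instance Definition _ :=
  GRing.isLinear.Build F AF (ext_power r 'cV[F]_n) *:%R eval_wedge
    eval_wedge_linear.

(** On a basis wedge, the sign in front of the term of [s] cancels the sign from reordering the
    wedge, so all r! terms are equal. *)
Lemma eval_section_map (x : ext_power r 'cV[F]_n) :
  eval_wedge (section_map x) = r`!%:R *: x.
Proof.
pose g1 : {linear _ -> ext_power r 'cV[F]_n} := eval_wedge \o section_map.
pose g2 : {linear _ -> ext_power r 'cV[F]_n} := r`!%:R \*: idfun.
suff g12 : g1 =1 g2 by exact: g12 x.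
apply: ext_power_basis_ext => phi /=.
rewrite section_map_basis linear_sum -card_Sn -sum1_card natr_sum scaler_suml.
apply: eq_big => [s|s _]; first by rewrite inE.
rewrite linearZ /= [eval_wedge _]extend_transf_wedge basis_wedge_perm.
by rewrite scalerA -signr_addb addbb.
Qed.

End Retract.

(** * Projectivity and indecomposability over a field where r! is invertible *)

Section ProjectiveIndecomposable.
Context {F : fieldType} {n r' : nat}.
Local Notation r := r'.+1.
Local Notation P := (ext_natural F n r).
Local Notation A := (monoid_alg F (transf n)).
Local Notation AF := {ffun transf n -> F^o}.
Hypotheses (r_le_n : (r <= n)%N) (rfact : r`!%:R != 0 :> F).
Local Notation w0 := (initial_wedge (F := F) r_le_n).

(** [P] carries scalars from [A], so a field scalar acts on it, and preserves its submodules,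
    through this element. *)
Definition const_alg (k : F) : A := k *: ((1 : A) : AF).

Lemma const_algE k (x : P) :
  const_alg k *: x = (k *: (x : ext_power r 'cV[F]_n)) :> P.
Proof.
rewrite [LHS]/(rep_scale _ _) /rep_scale.
under eq_bigr => f _ do rewrite ffunE -scalerA.
rewrite -scaler_sumr.
exact: (congr1 (fun y : ext_power r 'cV[F]_n => k *: y) (scale1r x)).
Qed.

Lemma mul_const_alg (a : A) k : a * const_alg k = k *: (a : AF).
Proof.
have := monoid_alg_mul_linear a k (1 : A) (0 : A).
by rewrite mulr1 mulr0 !addr0.
Qed.

Lemma const_algK k (x : P) :
  k != 0 -> const_alg k^-1 *: (const_alg k *: x) = x.
Proof.
move=> k0; rewrite scalerA.
have -> : const_alg k^-1 * const_alg k = 1.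
  by rewrite mul_const_alg scalerA mulfV //; exact: (scale1r (s := AF)).
by rewrite scale1r.
Qed.

(** Dividing [w0] by r! removes the factor in [eval_section_map]; in particular [w0] generates
    [P]. *)
Lemma section_map_initial (x : P) :
  (section_map x : A) *: (const_alg r`!%:R^-1 *: w0) = x.
Proof.
rewrite scalerA mul_const_alg -/(eval_wedge r_le_n _) linearZ /=.
by rewrite eval_section_map scalerA mulVf // scale1r.
Qed.

(** A preimage [x0] of the image under [f] of [w0] divided by r! determines the lift: each [p] is
    [section_map p] times that generator, and goes to [section_map p] times [x0]. *)
Lemma ext_natural_projective : projective P.
Proof.
move=> X Y g f g_surj; have [x0 gx0] := g_surj (f (const_alg r`!%:R^-1 *: w0)).
pose h (p : P) : X := (section_map p : A) *: x0.
have h_linear : linear h.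
  move=> a p q; rewrite /h.
  have -> : section_map (a *: p + q) = a * (section_map p : A) + section_map q :> A.
    by rewrite -section_map_scale; exact: (linearD section_map).
  by rewrite scalerDl scalerA.
pose hL := GRing.isLinear.Build A P X *:%R h h_linear.
pose hM : {linear P -> X} := HB.pack h hL.
by exists hM => p; rewrite /= /h linearZ /= gx0 -linearZ /= section_map_initial.
Qed.

Let e : transf n := extend_transf (initial_emb r_le_n).

Lemma projection_basis_wedge (phi : {ffun 'I_r -> 'I_n}) :
  exists k : F, ext_rep (nat_rep F n) r e (basis_wedge phi) = k *: w0.
Proof.
rewrite ext_rep_basis_wedge.
pose theta (i : 'I_r) : 'I_r := inord (phi i).
have -> : [ffun i => e (phi i)] = [ffun i => initial_emb r_le_n (theta i)].
  by apply/ffunP=> i; rewrite !ffunE.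
(* Folded into the first r indices, the slots are either a permutation of them, giving a sign, or
   contain a repetition, giving 0. *)
have [/injectiveP theta_inj|] := boolP (injectiveb theta).
  exists ((-1) ^+ perm theta_inj); rewrite -basis_wedge_perm; congr basis_wedge.
  by apply/ffunP=> i; rewrite !ffunE permE.
case/injectivePn=> i [j ij theta_ij]; exists 0; rewrite scale0r.
apply: (wedge_alternating _ _).2 ij _.
by rewrite !ffunE theta_ij.
Qed.

(** Since [w0] generates, [x] is a combination of translates of [w0]; these are basis wedges, and
    [e] sends each to a multiple of [w0]. *)
Lemma projection_image (x : P) :
  exists k, monoid_alg_elt F e *: x = const_alg k *: w0.
Proof.
rewrite -[x]section_map_initial scalerA; set a := _ * _.
rewrite [a *: _]/(rep_scale _ _) /rep_scale rep_module_eltE linear_sum.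
elim/big_ind: _ => [|_ _ [k ->] [l ->]|f _]; first by exists 0; rewrite const_algE scale0r.
  by exists (k + l); rewrite !const_algE scalerDl.
rewrite linearZ /= ext_rep_basis_wedge.
have [k ->] := projection_basis_wedge [ffun i => f (initial_emb r_le_n i)].
by exists (a f * k); rewrite const_algE scalerA.
Qed.

Lemma projection_initial : monoid_alg_elt F e *: w0 = w0.
Proof. exact: extend_transf_wedge. Qed.

Lemma ext_natural_indecomposable : indecomposable P.
Proof.
split; first by exists w0; exact: basis_wedge_neq0 (initial_emb_inj r_le_n).
move=> U W Usub Wsub UW_sum UW0.
(* A submodule with an element that [e] sends to a nonzero multiple of [w0] contains [w0], hence
   everything. *)
have initial_mem (S : {pred P}) k u : submod_closed S -> u \in S ->
    k != 0 -> monoid_alg_elt F e *: u = const_alg k *: w0 -> forall x, x \in S.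
  move=> [S0 Slin] uS k0 eu x.
  have scaleS a y : y \in S -> a *: y \in S.
    by move=> yS; rewrite -[_ *: y]addr0; exact: Slin.
  rewrite -[x]section_map_initial; apply/scaleS/scaleS.
  suff -> : w0 = const_alg k^-1 *: (monoid_alg_elt F e *: u) by apply/scaleS/scaleS.
  by rewrite eu const_algK.
have [u [w [uU wW w0E]]] := UW_sum w0.
have [k eu] := projection_image u; have [l ew] := projection_image w.
(* If [k] is nonzero, [U] is everything and [W] vanishes; otherwise [e] kills [u] and so sends [w]
   to [w0], and the roles are exchanged. *)
have [k0|k_neq0] := eqVneq k 0; last first.
  by right=> x; apply: UW0; exact: (initial_mem U k u Usub uU k_neq0 eu).
left=> x xU; apply: (UW0 x xU).
apply: (initial_mem W 1 w Wsub wW (oner_neq0 F)).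
have eu0 : monoid_alg_elt F e *: u = 0 by rewrite eu k0 const_algE; exact: (scale0r (w0 : ext_power r 'cV[F]_n)).
have w01 : const_alg 1 *: w0 = w0 by rewrite const_algE; exact: (scale1r (w0 : ext_power r 'cV[F]_n)).
have := scalerDr (monoid_alg_elt F e) u w; rewrite -w0E eu0 add0r w01 => <-.
exact: projection_initial.
Qed.

End ProjectiveIndecomposable.

Theorem theorem3p1 (R : realType) (n r : nat) (n_ge1 : (1 <= n)%N)
    (r_bounds : (1 <= r <= n)%N) :
  projective (ext_natural R[i] n r) /\ indecomposable (ext_natural R[i] n r).
Proof.
case: r r_bounds => [//|r] /andP[_ r_le_n].
(* Characteristic zero makes r! invertible. *)
have rfact : (r.+1)`!%:R != 0 :> R[i] by rewrite pnatr_eq0 -lt0n fact_gt0.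
split; [exact: ext_natural_projective | exact: ext_natural_indecomposable].
Qed.
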